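(* Let $\pi$ be a set of primes, and let $G$ be a finite group with subgroups $K$, $C$, $D$ such that $G = KC = KD = DC$ and $K$ is normal in $G$. Assume that each of the groups $G$, $D$ and $C$ satisfies the $\pi$-Sylow theorem. Then there exist a Hall $\pi$-subgroup $G_\pi$ of $G$, a Hall $\pi$-subgroup $K_\pi$ of $K$, a Hall $\pi$-subgroup $D_\pi$ of $D$ and a Hall $\pi$-subgroup $C_\pi$ of $C$ such that $G_\pi = K_\pi C_\pi = K_\pi D_\pi = D_\pi C_\pi$.
   Context: All groups are finite. For subgroups $A,B$ of a group $G$, $AB=\{ab : a\in A, b\in B\}$. For a set of primes $\pi$, a $\pi$-subgroup is a subgroup all of whose order's prime divisors lie in $\pi$; a Hall $\pi$-subgroup of a finite group is a $\pi$-subgroup whose index is divisible by no prime in $\pi$. A finite group $X$ is said to satisfy the $\pi$-Sylow theorem (property $D_\pi$) if every $\pi$-subgroup of $X$ is contained in a Hall $\pi$-subgroup of $X$ and any two Hall $\pi$-subgroups of $X$ are conjugate in $X$. *)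

(* Defs.v *)
From mathcomp Require Import all_boot all_fingroup all_solvable.

Set Implicit Arguments.
Unset Strict Implicit.
Unset Printing Implicit Defensive.

Local Open Scope group_scope.

(* Property D_pi.  A set of primes is a [nat_pred]; membership of non-primes in
   [pi] is irrelevant, since [pi.-group] and [pi.-Hall(_)] only test the prime
   divisors of orders and indices. *)
Definition pi_sylow_theorem (gT : finGroupType) (pi : nat_pred)
    (X : {group gT}) : Prop :=
  (forall P : {group gT}, P \subset X -> pi.-group P ->
     exists2 H : {group gT}, pi.-Hall(X) H & P \subset H) /\
  (forall H1 H2 : {group gT}, pi.-Hall(X) H1 -> pi.-Hall(X) H2 ->
     exists2 x, x \in X & H2 :=: H1 :^ x).

(* Main.v *)
(* Conjugating by the factors of an element of G = DC, one finds Hall subgroups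
   of D and of C inside a common Hall subgroup H of G; K :&: H is a Hall subgroup
   of K by normality.  Each of the three products lies in H, and already has
   at least |G|_pi elements, because |A||B| = |AB||A :&: B|. *)
Require Import Defs.
From mathcomp Require Import all_boot all_fingroup all_solvable.

Local Open Scope group_scope.

Lemma Hall_mulg_factors (gT : finGroupType) (pi : nat_pred)
    (G A B H A1 B1 : {group gT}) :
    G = A * B :> {set gT} -> pi.-Hall(G) H ->
    pi.-Hall(A) A1 -> pi.-Hall(B) B1 -> A1 \subset H -> B1 \subset H ->
  H = A1 * B1 :> {set gT}.
Proof.
move=> defG hallH hallA hallB sA1H sB1H.
apply/esym/eqP; rewrite eqEcard mul_subG //=.
have piAB1 : pi.-group (A1 :&: B1).
  exact: pgroupS (subsetIl _ _) (pHall_pgroup hallA).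
have sAB1 : A1 :&: B1 \subset A :&: B.
  by rewrite setISS ?(pHall_sub hallA) ?(pHall_sub hallB).
(* Only an upper bound is at stake: [A1 :&: B1] is a pi-subgroup of [A :&: B], so its order divides
   the pi-part of [#|A :&: B|], whether or not it is a Hall subgroup there. *)
have leAB1 : #|A1 :&: B1| <= #|A :&: B|`_pi.
  rewrite -(part_pnat_id piAB1) dvdn_leq ?part_gt0 //.
  exact: partn_dvd (cardG_gt0 _) (cardSg sAB1).
have cardG : (#|G|`_pi * #|A :&: B|`_pi = #|A1| * #|B1|)%N.
  by rewrite (card_Hall hallA) (card_Hall hallB) -!partnM // defG mul_cardG.
rewrite -(leq_pmul2r (part_gt0 pi #|A :&: B|)) (card_Hall hallH) cardG.
by rewrite mul_cardG leq_mul2l leAB1 orbT.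
Qed.
Arguments Hall_mulg_factors {gT pi G A B H A1 B1}.

Lemma pi_sylow_Hall_exists (gT : finGroupType) (pi : nat_pred)
    (X : {group gT}) :
  pi_sylow_theorem pi X -> exists H : {group gT}, pi.-Hall(X) H.
Proof.
by case=> exH _; case: (exH 1%G (sub1G X) (pgroup1 _ pi)) => H; exists H.
Qed.
Arguments pi_sylow_Hall_exists {gT pi X}.

Lemma pi_sylow_Hall_factors (gT : finGroupType) (pi : nat_pred)
    (G A B : {group gT}) :
    G = A * B :> {set gT} -> pi_sylow_theorem pi G ->
    pi_sylow_theorem pi A -> pi_sylow_theorem pi B ->
  exists H A1 B1 : {group gT},
    [/\ pi.-Hall(G) H, pi.-Hall(A) A1, pi.-Hall(B) B1,
        A1 \subset H & B1 \subset H].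
Proof.
move=> defG [exG conjG] /pi_sylow_Hall_exists[A1 hallA].
case/pi_sylow_Hall_exists=> B1 hallB.
have sAG : A \subset G by rewrite defG mulG_subl.
have sBG : B \subset G by rewrite defG mulG_subr.
have [H hallH sA1H] :=
  exG A1 (subset_trans (pHall_sub hallA) sAG) (pHall_pgroup hallA).
have [L hallL sB1L] :=
  exG B1 (subset_trans (pHall_sub hallB) sBG) (pHall_pgroup hallB).
have [g + defL] := conjG H L hallH hallL.
rewrite {1}defG => /mulsgP[a b Aa Bb def_g].
(* Since [L = H :^ (a * b)], the groups [H :^ a] and [L :^ b^-1] coincide, so this one group
   contains both [A1 :^ a] and [B1 :^ b^-1]. These remain Hall in [A] and [B] because [a] lies in
   [A] and [b] in [B]. *)
exists (H :^ a)%G, (A1 :^ a)%G, (B1 :^ b^-1)%G.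
split=> /=; rewrite ?conjSg ?pHallJ ?groupV //.
  exact: (subsetP sAG).
by rewrite sub_conjgV -conjsgM -def_g -defL.
Qed.
Arguments pi_sylow_Hall_factors {gT pi G A B}.

Theorem theorem2 (gT : finGroupType) (pi : nat_pred) (G K C D : {group gT})
    (sCG : C \subset G) (sDG : D \subset G) (nKG : K <| G)
    (defG_KC : G = K * C :> {set gT})
    (defG_KD : G = K * D :> {set gT})
    (defG_DC : G = D * C :> {set gT})
    (dpiG : pi_sylow_theorem pi G)
    (dpiD : pi_sylow_theorem pi D)
    (dpiC : pi_sylow_theorem pi C) :
  exists Gpi Kpi Dpi Cpi : {group gT},
    [/\ pi.-Hall(G) Gpi, pi.-Hall(K) Kpi, pi.-Hall(D) Dpi & pi.-Hall(C) Cpi] /\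
    [/\ Gpi = Kpi * Cpi :> {set gT},
        Gpi = Kpi * Dpi :> {set gT} &
        Gpi = Dpi * Cpi :> {set gT}].
Proof.
(* The factorization [D * C] fixes [H]: Hall subgroups of [D] and [C] must be conjugated to fit into
   a common [H], whereas [H :&: K] is Hall in [K] for whichever [H] results. *)
have [H [D1 [C1 [hallH hallD hallC sD1H sC1H]]]] :=
  pi_sylow_Hall_factors defG_DC dpiG dpiD dpiC.
have hallK : pi.-Hall(K) (H :&: K) by exact: Hall_setI_normal nKG hallH.
have sKH : H :&: K \subset H by exact: subsetIl.
exists H, (H :&: K)%G, D1, C1; split=> //; split.
- exact: Hall_mulg_factors defG_KC hallH hallK hallC sKH sC1H.
- exact: Hall_mulg_factors defG_KD hallH hallK hallD sKH sD1H.
exact: Hall_mulg_factors defG_DC hallH hallD hallC sD1H sC1H.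
Qed.
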